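(* Let $k\geqslant1$ be an integer and let $S$ be a set of $n$ points in $\mathbb{R}^3$ such that no three points of $S$ are collinear and at most $n-k$ points of $S$ lie on any common plane. If $n\geqslant \left(184+\frac{8}{25}\right)k^2+4k$, then \[ m_3+m_4\geqslant k\binom{n-k}{2}-(n-k)\binom{k}{2}, \] where $m_j$ denotes the number of planes containing exactly $j$ points of $S$. *)

(* Defs.v *)
From HB Require Import structures.
From mathcomp Require Import all_boot all_order all_algebra finmap.
From mathcomp Require Import all_classical all_reals ring lra.

Set Implicit Arguments.
Unset Strict Implicit.
Unset Printing Implicit Defensive.

Import Order.TTheory GRing.Theory Num.Theory.

Local Open Scope classical_set_scope.
Local Open Scope fset_scope.
Local Open Scope ring_scope.

Definition is_line (R : realType) (L : set 'rV[R]_3) : Prop :=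
  exists p v : 'rV[R]_3, v != 0 /\ L = [set p + t *: v | t in [set: R]].

Definition is_plane (R : realType) (P : set 'rV[R]_3) : Prop :=
  exists (a : 'rV[R]_3) (b : R),
    a != 0 /\ P = [set x | \sum_(i < 3) a 0 i * x 0 i = b].

Definition collinear (R : realType) (x y z : 'rV[R]_3) : Prop :=
  exists L : set 'rV[R]_3, [/\ is_line L, L x, L y & L z].

Definition no_three_collinear (R : realType) (S : {fset 'rV[R]_3}) : Prop :=
  forall x y z, x \in S -> y \in S -> z \in S ->
    x != y -> y != z -> x != z -> ~ collinear x y z.

Definition num_points_on (R : realType) (S : {fset 'rV[R]_3})
    (P : set 'rV[R]_3) : nat :=
  #|` [fset x in S | x \in P]|.

Definition planes_with (R : realType) (S : {fset 'rV[R]_3}) (j : nat) :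
    set (set 'rV[R]_3) :=
  [set P | is_plane P /\ num_points_on S P = j].

(* [fset_set] sends infinite sets to [fset0], so this is the number of planes
   only when [planes_with S j] is finite; [finite_planes_with] below shows that
   it is whenever j >= 3 and no three points of S are collinear. *)
Definition num_planes (R : realType) (S : {fset 'rV[R]_3}) (j : nat) : nat :=
  #|` fset_set (planes_with S j)|.

Lemma sum3E (R : realType) (a x : 'rV[R]_3) : \sum_(i < 3) a 0 i * x 0 i =
  a 0 0 * x 0 0 + a 0 1 * x 0 1 + a 0 (2%:R) * x 0 (2%:R).
Proof.
rewrite !big_ord_recl big_ord0 addr0 addrA.
by congr (_ * _ + _ * _ + _ * _); congr (_ _ _); apply/val_inj.
Qed.

Lemma fset_ge3 (K : choiceType) (A : {fset K}) : (3 <= #|` A|)%N ->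
  exists x y z, [/\ x \in A, y \in A & z \in A] /\
    [/\ x != y, y != z & x != z].
Proof.
case E : (enum_fset A) (fset_uniq A) => [|x [|y [|z s]]] /=; rewrite ?E //.
rewrite !inE !negb_or => /and3P[/and3P[xy xz _] /andP[yz _] _] _.
have inA w : (w \in A) = (w \in [:: x, y, z & s]) by rewrite -E.
by exists x, y, z; rewrite !inA !inE !eqxx !orbT.
Qed.

Lemma row3P (R : realType) (x y : 'rV[R]_3) :
  x 0 0 = y 0 0 -> x 0 1 = y 0 1 -> x 0 (2%:R) = y 0 (2%:R) -> x = y.
Proof.
move=> e0 e1 e2; apply/rowP => -[[|[|[|//]]] i3].
- by move: e0; congr (_ = _); congr (_ _ _); apply/val_inj.
- by move: e1; congr (_ = _); congr (_ _ _); apply/val_inj.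
- by move: e2; congr (_ = _); congr (_ _ _); apply/val_inj.
Qed.

Lemma row3_eq0 (R : realType) (x : 'rV[R]_3) : x != 0 ->
  [|| x 0 0 != 0, x 0 1 != 0 | x 0 (2%:R) != 0].
Proof.
apply: contraNT; rewrite !negb_or !negbK => /and3P[/eqP a /eqP b /eqP c].
by apply/eqP/row3P; rewrite mxE.
Qed.

(* Two vectors with zero cross product are parallel. *)
Lemma parallel3 (R : realType) (d u : 'rV[R]_3) : d != 0 ->
  u 0 0 * d 0 1 = u 0 1 * d 0 0 ->
  u 0 0 * d 0 (2%:R) = u 0 (2%:R) * d 0 0 ->
  u 0 1 * d 0 (2%:R) = u 0 (2%:R) * d 0 1 ->
  exists t, u = t *: d.
Proof.
move=> /row3_eq0/or3P[] d0 e1 e2 e3.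
- exists (u 0 0 / d 0 0); apply: row3P; rewrite !mxE.
  + by field.
  + by apply: (mulIf d0); rewrite -e1; field.
  + by apply: (mulIf d0); rewrite -e2; field.
- exists (u 0 1 / d 0 1); apply: row3P; rewrite !mxE.
  + by apply: (mulIf d0); rewrite e1; field.
  + by field.
  + by apply: (mulIf d0); rewrite -e3; field.
- exists (u 0 (2%:R) / d 0 (2%:R)); apply: row3P; rewrite !mxE.
  + by apply: (mulIf d0); rewrite e2; field.
  + by apply: (mulIf d0); rewrite e3; field.
  + by field.
Qed.

Lemma plane_unique (R : realType) (P Q : set 'rV[R]_3) (x y z : 'rV[R]_3) :
  is_plane P -> is_plane Q -> P x -> P y -> P z -> Q x -> Q y -> Q z ->
  ~ collinear x y z -> P = Q.
Proof.
move=> [a [b [a0 ->]]] [a' [b' [a'0 ->]]] /=; rewrite !sum3E.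
move=> Px Py Pz Qx Qy Qz nc.
pose d : 'rV[R]_3 := \row_(i < 3)
  (if i == 0 then a 0 1 * a' 0 (2%:R) - a 0 (2%:R) * a' 0 1
   else if i == 1 then a 0 (2%:R) * a' 0 0 - a 0 0 * a' 0 (2%:R)
   else a 0 0 * a' 0 1 - a 0 1 * a' 0 0).
have d_0 : d 0 0 = a 0 1 * a' 0 (2%:R) - a 0 (2%:R) * a' 0 1 by rewrite mxE.
have d_1 : d 0 1 = a 0 (2%:R) * a' 0 0 - a 0 0 * a' 0 (2%:R) by rewrite mxE.
have d_2 : d 0 (2%:R) = a 0 0 * a' 0 1 - a 0 1 * a' 0 0 by rewrite mxE.
have [d0|dn0] := eqVneq d 0.
  move: d_0 d_1 d_2; rewrite d0 !mxE => d_0 d_1 d_2.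
  have [||| t ta] := @parallel3 R a a' a0; [lra|lra|lra|].
  have t0 : t != 0 by apply: contraNneq a'0 => t0; rewrite ta t0 scale0r.
  have eb : b' = t * b by rewrite -Qx -Px ta !mxE; ring.
  apply/seteqP; split=> w /=; rewrite !sum3E ta eb !mxE.
    by move=> <-; ring.
  by move=> e; apply: (mulfI t0); rewrite -e; ring.
have on_d (w : 'rV[R]_3) : \sum_(i < 3) a 0 i * w 0 i = b ->
    \sum_(i < 3) a' 0 i * w 0 i = b' -> exists t, w = x + t *: d.
  rewrite !sum3E => aw a'w.
  pose u := w - x.
  have A0 : a 0 0 * u 0 0 + a 0 1 * u 0 1 + a 0 (2%:R) * u 0 (2%:R) = 0.
    by rewrite !mxE; lra.
  have A'0 : a' 0 0 * u 0 0 + a' 0 1 * u 0 1 + a' 0 (2%:R) * u 0 (2%:R) = 0.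
    by rewrite !mxE; lra.
  have [||| t E] := @parallel3 R d u dn0; rewrite ?d_0 ?d_1 ?d_2.
  - apply/eqP; rewrite -subr_eq0; apply/eqP.
    pose F (p q : R) := a 0 (2%:R) * q - a' 0 (2%:R) * p.
    by move: (f_equal2 F A0 A'0); rewrite {}/F !mulr0 subrr => <-; ring.
  - apply/eqP; rewrite -subr_eq0; apply/eqP.
    pose F (p q : R) := a' 0 1 * p - a 0 1 * q.
    by move: (f_equal2 F A0 A'0); rewrite {}/F !mulr0 subrr => <-; ring.
  - apply/eqP; rewrite -subr_eq0; apply/eqP.
    pose F (p q : R) := a 0 0 * q - a' 0 0 * p.
    by move: (f_equal2 F A0 A'0); rewrite {}/F !mulr0 subrr => <-; ring.
  by exists t; rewrite -E addrC subrK.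
case: nc; exists [set x + t *: d | t in [set: R]]; split; first by exists x, d.
- by exists 0 => //; rewrite scale0r addr0.
- by have [||t ->] := on_d y; rewrite ?sum3E //; exists t.
- by have [||t ->] := on_d z; rewrite ?sum3E //; exists t.
Qed.

Lemma finite_planes_with (R : realType) (S : {fset 'rV[R]_3}) (j : nat) :
  (3 <= j)%N -> no_three_collinear S -> finite_set (planes_with S j).
Proof.
move=> j3 hS.
pose f (P : set 'rV[R]_3) := [fset x in S | x \in P].
have fin : finite_set (f @` planes_with S j).
  apply: (@sub_finite_set _ _ [set` fpowerset S]); last exact: finite_fset.
  by move=> _ [P _ <-] /=; rewrite fpowersetE fset_sub.
suff injf : {in planes_with S j &, injective f}.
  by rewrite -(eq_finite_set (inj_card_eq injf)).
move=> P Q /set_mem[pP cP] /set_mem[pQ _] fPQ.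
have [|x [y [z [[xf yf zf] [xy yz xz]]]]] := @fset_ge3 _ (f P).
  by rewrite -[#|` _|]/(num_points_on S P) cP.
have inf A w : w \in f A -> w \in S /\ A w.
  by rewrite !inE => /andP[wS /set_mem].
have [[xS Px] [yS Py] [zS Pz]] := And3 (inf P x xf) (inf P y yf) (inf P z zf).
move: xf yf zf; rewrite fPQ => /inf[_ Qx] /inf[_ Qy] /inf[_ Qz].
by apply: (plane_unique pP pQ Px Py Pz) => //; apply: hS.
Qed.

(* Main.v *)
(** Through three points of S there is exactly one plane, so the traces on S of
    the planes form a design in which any three points lie in a unique block.

    If some block has n - k' points with k <= k' <= 15k, count the blocks that
    meet it in exactly two points.  Let such a block have j further points: the
    sum of j is exactly k' * C(n-k', 2), while the sum of C(j, 2) is at most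
    C(k', 2) * (n-k') / 2, because the blocks through two given outside points
    cut the rich block in disjoint pairs.  As j - C(j, 2) <= 0 unless j is 1 or
    2, the difference of the two sums bounds the number of 3- and 4-point
    blocks from below.

    Otherwise project S from each of its points p and dualize: the n - 1 other
    points become lines, the planes through p become their crossing points, and
    Melchior's inequality, in the weak form
    "sum of multiplicities <= 3 * crossings + lines", bounds the number of point
    incidences at p by the number of 3- and 4-point planes through p.  As no
    block is too rich, there are at least (9k + 4)(n - 1) incidences at p. *)
Require Import Defs.
From HB Require Import structures.
From mathcomp Require Import all_boot all_order all_algebra finmap.
From mathcomp Require Import all_classical all_reals.
From mathcomp Require Import zify ring lra.

Set Implicit Arguments.
Unset Strict Implicit.
Unset Printing Implicit Defensive.

Import Order.TTheory GRing.Theory Num.Theory.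

(** * Designs in which three points determine a block *)

Definition through (T : finType) (a : T) (F : {set {set T}}) : {set {set T}} :=
  [set P in F | a \in P].

Definition steiner3 (T : finType) (F : {set {set T}}) : Prop :=
  (forall P, P \in F -> 3 <= #|P|) /\
  (forall a b c, a != b -> b != c -> a != c ->
    #|through a (through b (through c F))| = 1).

Lemma throughE (T : finType) (a : T) (F : {set {set T}}) P :
  (P \in through a F) = (P \in F) && (a \in P).
Proof. by rewrite inE. Qed.

(** Double counting of the pairs of a point of [A] and a block through it. *)
Lemma sum_weight_setI (T : finType) (F : {set {set T}}) (A : {set T})
    (g : {set T} -> nat) :
  \sum_(P in F) g P * #|P :&: A| = \sum_(a in A) \sum_(P in through a F) g P.
Proof.
rewrite (eq_bigr (fun P : {set T} => \sum_(a in A | a \in P) g P)); last first.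
  move=> P _; rewrite sum_nat_cond_const mulnC; congr (_ * _).
  by apply: eq_card => a; rewrite !inE andbC.
rewrite (exchange_big_dep (mem A)) /=; last by move=> ? ? _ /andP[].
apply: eq_bigr => a aA; apply: eq_bigl => P.
by rewrite !inE aA.
Qed.

Lemma sum_card_setI (T : finType) (F : {set {set T}}) (A : {set T}) :
  \sum_(P in F) #|P :&: A| = \sum_(a in A) #|through a F|.
Proof.
under eq_bigr do rewrite -[#|_|]mul1n.
by rewrite sum_weight_setI; apply: eq_bigr => a _; rewrite sum1_card.
Qed.

(** The blocks through [p] and [q] partition the remaining points, as each of these lies in exactly
    one of them. *)
Lemma pencil_sum (T : finType) (F : {set {set T}}) (p q : T) (A : {set T}) :
  steiner3 F -> p != q -> p \notin A -> q \notin A ->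
  \sum_(P in through p (through q F)) #|P :&: A| = #|A|.
Proof.
move=> [_ F1] pq pA qA; rewrite sum_card_setI -sum1_card.
by apply: eq_bigr => a aA; apply: F1 => //;
  apply: contraTneq aA => ->.
Qed.

Lemma block_inj (T : finType) (F : {set {set T}}) (P Q : {set T}) (a b c : T) :
  steiner3 F -> P \in F -> Q \in F -> a != b -> b != c -> a != c ->
  a \in P -> b \in P -> c \in P -> a \in Q -> b \in Q -> c \in Q -> P = Q.
Proof.
move=> [_ F1] PF QF ab bc ac aP bP cP aQ bQ cQ.
have /eqP/cards1P[X EX] := F1 a b c ab bc ac.
have : P \in [set X] by rewrite -EX !throughE PF aP bP cP.
have : Q \in [set X] by rewrite -EX !throughE QF aQ bQ cQ.
by rewrite !inE => /eqP -> /eqP ->.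
Qed.

Lemma block_setI (T : finType) (F : {set {set T}}) (P Q : {set T}) :
  steiner3 F -> P \in F -> Q \in F -> P != Q -> #|P :&: Q| <= 2.
Proof.
move=> F3 PF QF; apply: contraNT; rewrite -ltnNge => /card_gt2P[a [b [c [[]]]]].
rewrite !inE => /andP[aP aQ] /andP[bP bQ] /andP[cP cQ] [ab bc ca].
by apply/eqP/(block_inj (a := a) (b := b) (c := c) F3); rewrite // eq_sym.
Qed.

(** * Counting around a rich block *)

Definition ordinary (T : finType) (F : {set {set T}}) : {set {set T}} :=
  [set P in F | (#|P| == 3) || (#|P| == 4)].

Lemma ordinary_of_rich (T : finType) (F : {set {set T}}) (P0 : {set T}) :
  steiner3 F -> P0 \in F ->
  2 * (#|~: P0| * (#|P0| * #|P0|.-1)) <=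
    4 * #|ordinary F| + #|~: P0| * #|~: P0|.-1 * #|P0|.
Proof.
move=> F3 P0F; set r := #|P0|; set k := #|~: P0|.
pose Q := [set P in F | #|P :&: P0| == 2].
have QF P : P \in Q -> P \in F by rewrite inE => /andP[].
have Q2 P : P \in Q -> #|P :&: P0| = 2 by rewrite inE => /andP[_ /eqP].
pose j (P : {set T}) := #|P :&: ~: P0|.
(* For [q] off [P0] and [a] on it, the blocks through both partition the other [r - 1] points of
   [P0]. Those in [Q] take one point each and the rest none, so [r - 1] of them lie in [Q]. *)
have S1 : 2 * \sum_(P in Q) j P = k * (r * r.-1).
  have -> : 2 * \sum_(P in Q) j P = \sum_(P in Q) j P * #|P :&: P0|.
    by rewrite mulnC big_distrl; apply: eq_bigr => P /Q2 ->.
  rewrite sum_weight_setI.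
  under eq_bigr do rewrite sum_card_setI.
  rewrite exchange_big /= -!sum_nat_const; apply: eq_bigr => q.
  rewrite inE => qP0; apply: eq_bigr => a aP0.
  have qa : q != a by apply: contraNneq qP0 => ->.
  have -> : r.-1 = #|P0 :\ a| by rewrite /r (cardsD1 a P0) aP0.
  rewrite -(pencil_sum F3 qa); rewrite ?inE ?eqxx ?(negPf qP0) ?andbF //.
  rewrite -sum1_card [RHS](bigID (mem Q)) /= [X in _ = _ + X]big1 ?addn0.
    apply: eq_big => [P|P].
      by rewrite !throughE !inE; case: (P \in F); case: (_ == 2);
        case: (a \in P); case: (q \in P).
    rewrite !throughE => /andP[/andP[/Q2 + aP] _].
    by rewrite (cardsD1 a) inE aP aP0 finset.setIDA add1n => -[->].
  move=> P; rewrite !throughE [P \in Q]inE => /andP[/andP[/andP[PF aP] qP]].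
  rewrite PF /= => neq2.
  have PP0 : P != P0 by apply: contraNneq qP0 => <-.
  have := block_setI F3 PF P0F PP0.
  by move: neq2; rewrite (cardsD1 a) inE aP aP0 finset.setIDA /=;
    case: #|_| => [|[]].
(* The blocks through [q] and [q'] cut [P0] in disjoint sets, which are pairs for members of [Q]; so
   at most [r / 2] of them lie in [Q]. *)
have S2 : 2 * \sum_(P in Q) j P * (j P).-1 <= k * k.-1 * r.
  under eq_bigr do rewrite mulnC.
  rewrite sum_weight_setI big_distrr /= -mulnA -sum_nat_const.
  apply: leq_sum => q; rewrite inE => qP0.
  have -> : \sum_(P in through q Q) (j P).-1 =
      \sum_(P in through q Q) #|P :&: (~: P0 :\ q)|.
    apply: eq_bigr => P; rewrite throughE => /andP[_ qP].
    by rewrite /j (cardsD1 q) !inE qP qP0 finset.setIDA.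
  rewrite sum_card_setI big_distrr /=.
  have -> : k.-1 = #|~: P0 :\ q| by rewrite /k (cardsD1 q (~: P0)) inE qP0.
  rewrite -sum_nat_const; apply: leq_sum => q'; rewrite !inE => /andP[q'q q'P0].
  rewrite -[r](pencil_sum F3 q'q) // mulnC -sum_nat_const.
  rewrite [X in _ <= X](bigID (mem Q)) /= -[X in X <= _]addn0 leq_add //.
  rewrite [X in _ <= X](eq_big (mem (through q' (through q Q))) (fun=> 2)) //.
    move=> P; rewrite !throughE !inE.
    by case: (P \in F); case: (_ == 2); case: (q \in P); case: (q' \in P).
  by move=> P /andP[_ /Q2].
(* As [#|P| = j + 2], this is [j <= [j = 1 or 2] + C(j, 2)] for each block, times 4. *)
have pointwise : 4 * \sum_(P in Q) j P <=
    4 * \sum_(P in Q) (P \in ordinary F) + 2 * \sum_(P in Q) j P * (j P).-1.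
  rewrite !big_distrr -big_split /=.
  apply: leq_sum => P PQ;
    rewrite inE (QF _ PQ) -(cardsID P0 P) (Q2 _ PQ) finset.setDE -/(j P).
  by case: (j P) => [|[|[|m]]] //=; nia.
have : \sum_(P in Q) (P \in ordinary F) <= #|ordinary F|.
  rewrite -big_mkcondr -sum1_card [X in _ <= X](bigID (mem Q)) /= addnC.
  by apply: leq_trans (leq_addl _ _); rewrite eq_leq //; apply: eq_bigl => P;
    rewrite andbC.
lia.
Qed.

(* The weights come from j <= 6 [j = 2] + 3 [j = 3] + 4 (j - 3) for j >= 2, and
   6 * 3, 3 * 4 <= 18 when they are summed over the points of a plane. *)
Lemma sum_incidence_le (T : finType) (F : {set {set T}}) (p : T) :
  steiner3 F ->
  \sum_(P in through p F) #|P|.-1 <= 3 * #|through p F| + #|T|.-1 ->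
  \sum_(P in through p F) #|P|.-1 <=
    \sum_(P in through p F) (6 * (#|P| == 3) + 3 * (#|P| == 4)) + 4 * #|T|.-1.
Proof.
move=> [F3 _]; set I := \sum_(P in _) _; set W := \sum_(P in _) _ => mel.
suff : #|through p F| * 12 + I <= W + 4 * I by lia.
rewrite /I /W -sum_nat_const big_distrr -!big_split /=.
apply: leq_sum => P; rewrite throughE => /andP[/F3 + _].
by case: #|P| => [|[|[|[|[|m]]]]] //= _; lia.
Qed.

Lemma sum_ordinary (T : finType) (F : {set {set T}}) :
  \sum_(p : T) \sum_(P in through p F) (6 * (#|P| == 3) + 3 * (#|P| == 4)) <=
    18 * #|ordinary F|.
Proof.
rewrite [X in X <= _](eq_bigl (mem [set: T])) => [|p]; last by rewrite /= inE.
rewrite -sum_weight_setI.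
rewrite -sum1_card big_distrr /= [X in _ <= X]big_mkcond [X in X <=
  _]big_mkcond.
apply: leq_sum => P _; rewrite inE finset.setIT.
by case: (P \in F) => //=; case: eqP => [->|_] //; case: eqP => [->|_].
Qed.

(** * Degrees and incidences at a point *)

Lemma sum_degree (T : finType) (F : {set {set T}}) (p : T) :
  \sum_(P in through p F) #|P|.-1 =
    \sum_(q in [set~ p]) #|through q (through p F)|.
Proof.
rewrite -sum_card_setI; apply: eq_bigr => P; rewrite throughE => /andP[_ pP].
by rewrite (cardsD1 p) pP finset.setDE.
Qed.

(** A block through [p] and [q] meets [M] in [p] and at most one more point, and these blocks
    together cover [M]. *)
Lemma degree_ge_block (T : finType) (F : {set {set T}}) (M : {set T}) (p q : T)
  :
  steiner3 F -> M \in F -> p \in M -> q \notin M ->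
  #|M|.-1 <= #|through q (through p F)|.
Proof.
move=> F3 MF pM qM; have qp : q != p by apply: contraNneq qM => ->.
have -> : #|M|.-1 = #|M :\ p| by rewrite (cardsD1 p M) pM.
rewrite -(pencil_sum F3 qp); rewrite ?inE ?eqxx ?(negPf qM) ?andbF //.
rewrite -sum1_card; apply: leq_sum => P;
  rewrite !throughE => /andP[/andP[PF pP] qP].
have PM : P != M by apply: contraNneq qM => <-.
by have := block_setI F3 PF MF PM; rewrite (cardsD1 p) inE pP pM finset.setIDA.
Qed.

Lemma degree_ge_small (T : finType) (F : {set {set T}}) (m : nat) (p q : T) :
  steiner3 F -> q != p -> (forall P, P \in F -> p \in P -> #|P| <= m.+2) ->
  #|T|.-2 <= #|through q (through p F)| * m.
Proof.
move=> F3 qp small.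
have -> : #|T|.-2 = #|[set~ p] :\ q|.
  by have := cardsC1 p; rewrite (cardsD1 q) !inE qp add1n => <-.
rewrite -(pencil_sum F3 qp); rewrite ?inE ?eqxx ?andbF //.
rewrite -sum_nat_const; apply: leq_sum => P.
rewrite !throughE => /andP[/andP[PF pP] qP].
have := small P PF pP; rewrite (cardsD1 p) pP (cardsD1 q) !inE qp qP /=.
by rewrite !add1n !ltnS finset.setIDA -finset.setDE.
Qed.

Lemma incidence_ge (T : finType) (F : {set {set T}}) (k : nat) (p : T) :
  steiner3 F -> 0 < k -> 184 * k ^ 2 + 4 * k < #|T| ->
  (forall P, P \in F -> #|P| + 15 * k < #|T|) ->
  (9 * k + 4) * #|T|.-1 <= \sum_(P in through p F) #|P|.-1.
Proof.
move=> F3 k0; set n := #|T| => nk small; rewrite sum_degree.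
(* A block M through p with r + 1 points, 14k < r, gives degree at least r to
   the points off M; if there is none, every degree is at least
   (n - 2) / (14k - 1). *)
have [/existsP[M /and3P[MF pM M_ge]] | /existsPn noM] :=
  boolP [exists M in F, (p \in M) && (14 * k + 2 <= #|M|)].
  have : \sum_(q in ~: M) #|M|.-1 <= \sum_(q in [set~ p]) #|through q (through
    p F)|.
    rewrite [X in _ <= X](bigID (mem (~: M))) /=;
      apply: leq_trans (leq_addr _ _).
    rewrite [X in _ <= X](eq_bigl (mem (~: M))); last first.
      move=> q /=; rewrite !inE; case: (boolP (q \in M)); rewrite ?andbF //.
      by move=> qM; rewrite andbT; apply: contraNneq qM => ->.
    by apply: leq_sum => q; rewrite inE; apply: degree_ge_block.
  apply: leq_trans; rewrite sum_nat_const.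
  have := small M MF; have := cardsC M; rewrite -/n.
  rewrite expnS expn1 in nk; move: M_ge nk; move: #|M| #|~: M| (n) => r m N.
  move=> M_ge nk rN rm; rewrite -{}rN in rm nk *.
  case: k k0 M_ge rm nk {small} => // l _ M_ge rm.
  (* The claim is [(9k + 4)(r + m - 1) <= m(r - 1)]; the excesses [u] and [w] over the least values
     expose its monomials to linear arithmetic. *)
  have [u ->] : exists u, r = 14 * l.+1 + 2 + u by exists (r - (14 * l.+1 +
    2)); lia.
  have [w ->] : exists w, m = 15 * l.+1 + 1 + w by exists (m - (15 * l.+1 +
    1)); lia.
  move=> nk; have := leq_mul (leqnn l) nk; lia.
have d_ge q : q \in [set~ p] -> 9 * k + 4 <= #|through q (through p F)|.
  rewrite !inE => qp.
  have small' P : P \in F -> p \in P -> #|P| <= (14 * k - 1).+2.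
    by move=> PF pP; have := noM P; rewrite PF pP /= -ltnNge; lia.
  have := degree_ge_small F3 qp small'; rewrite -/n.
  move: #|through _ _| => d le_d; rewrite leqNgt; apply/negP => lt_d.
  (* This would give [n - 2 <= (9k + 3)(14k - 1) < 184k^2 + 4k - 1]. *)
  have le_d9 : d <= 9 * k + 3 by lia.
  have := leq_mul le_d9 (leqnn (14 * k - 1)).
  case: k k0 nk le_d {small noM small' lt_d le_d9} => // l _ nk.
  have -> : 14 * l.+1 - 1 = 14 * l + 13 by lia.
  rewrite expnS expn1 in nk; lia.
rewrite mulnC -(cardsC1 p) -sum_nat_const; exact: leq_sum.
Qed.

(** * Combining the two cases *)

(** A block missing [k + d] points gives at least the bound wanted for [k]: the gain is about
    [d p^2], the losses are of order [k d p], and [p] is large against [k]. *)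
Lemma rich_arith (k d p m : nat) : 0 < k -> d <= 14 * k ->
  184 * k ^ 2 + 4 * k < k + d + p.+1 ->
  2 * ((k + d) * (p.+1 * p)) <= 4 * m + (k + d) * (k + d).-1 * p.+1 ->
  k * ((d + p.+1) * (d + p)) <= 2 * m + (d + p.+1) * (k * k.-1).
Proof.
case: k => // l _; rewrite expnS expn1 addSn /= => dl nk.
(* With [k = l + 1]: [p >= 184k^2 + 3k - d >= 184k^2 - 11k >= 173k]. *)
have p_ge : 173 * l.+1 <= p by lia.
have := leq_mul (leqnn (d * p)) p_ge.
have := leq_mul (leqnn (d * p)) dl.
have := leq_mul (leqnn (l * d)) p_ge.
have := leq_mul (leqnn (l * d)) dl.
have := leq_mul (leqnn d) p_ge.
have := leq_mul (leqnn d) dl.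
lia.
Qed.

Lemma steiner_ordinary (T : finType) (F : {set {set T}}) (k : nat) :
  steiner3 F ->
  (forall p, \sum_(P in through p F) #|P|.-1 <= 3 * #|through p F| + #|T|.-1) ->
  0 < k -> 184 * k ^ 2 + 4 * k < #|T| ->
  (forall P, P \in F -> #|P| <= #|T| - k) ->
  k * ((#|T| - k) * (#|T| - k).-1) <=
    2 * #|ordinary F| + (#|T| - k) * (k * k.-1).
Proof.
move=> F3 mel k0 nk P_le; have k2 : k <= k ^ 2 by rewrite expnS expn1 leq_pmulr.
have [/existsP[P0 /andP[P0F rich]] | /existsPn poor] :=
  boolP [exists P in F, #|T| <= #|P| + 15 * k].
  have := ordinary_of_rich F3 P0F; have := P_le _ P0F.
  move: rich nk; rewrite -(cardsC P0).
  move: #|P0| #|~: P0| #|ordinary F| => r k' m r_ge nk r_le.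
  have [d k'E] : exists d, k' = k + d by exists (k' - k); lia.
  rewrite {}k'E in r_ge nk r_le *.
  case: r r_ge nk r_le => [|p] r_ge nk r_le /=; first by lia.
  rewrite [p.+1 + _]addnC in nk * => le_m.
  have -> : k + d + p.+1 - k = d + p.+1 by lia.
  by rewrite addnS /= -addnS; apply: rich_arith => //; lia.
have small P : P \in F -> #|P| + 15 * k < #|T|.
  by move=> PF; have := poor P; rewrite PF /= -ltnNge.
have : \sum_(p : T) (9 * k + 4) * #|T|.-1 <= 18 * #|ordinary F| + \sum_(p : T)
  4 * #|T|.-1.
  apply: leq_trans (leq_add (sum_ordinary F) (leqnn _)).
  rewrite -big_split /=; apply: leq_sum => p _.
  exact: leq_trans (incidence_ge p F3 k0 nk small) (sum_incidence_le F3 (mel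
    p)).
rewrite !sum_nat_const; move: #|{: T}| #|ordinary F| nk => n m nk le_m.
have le1 : (n - k) * (n - k).-1 <= n * n.-1 by apply: leq_mul; lia.
have le2 := leq_mul (leqnn k) le1.
(* The terms [4n(n - 1)] on both sides of [le_m] cancel. *)
have le3 : 9 * (k * (n * n.-1)) <= 18 * m by move: (n.-1) le_m => p; lia.
apply: leq_trans (leq_addr _ _); lia.
Qed.

(** * Weak Melchior inequality for line arrangements *)

Local Open Scope ring_scope.

(** The difference of the two functions is increasing and changes sign between [t0] and [t1]. *)
Lemma affine_cross (R : realFieldType) (a b a' b' t0 t1 u : R) :
  t0 < t1 -> a * t0 + b < a' * t0 + b' -> a' * t1 + b' < a * t1 + b ->
  a * u + b = a' * u + b' -> t0 < u < t1.
Proof.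
move=> t01 l0 l1 e.
have a0 : 0 < a - a'.
  have t : 0 < t1 - t0 by rewrite subr_gt0.
  by rewrite -(pmulr_lgt0 _ t); lra.
by apply/andP; split; rewrite -subr_gt0 -(pmulr_rgt0 _ a0); lra.
Qed.

(** Each [i] in [D] is a line of slope [s i], and [v] in [V] is a crossing at [(h v, y v)]. An
    incidence is either the lowest on its line or the upper end of a gap, so incidences exceed gaps
    by at most [#|D|]. Intersecting with [D] allows [v] to contain an index that is no line. *)
Lemma sum_card_le_gaps (R : realFieldType) (T : finType) (D : {set T})
    (V : {set {set T}}) (s c : T -> R) (h y : {set T} -> R) :
  {in D &, injective s} ->
  (forall v i, v \in V -> i \in D -> (i \in v) = (s i * h v + c i == y v)) ->
  (forall v v', v \in V -> v' \in V -> h v = h v' -> y v = y v' -> v = v') ->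
  (forall i j, i \in D -> j \in D -> i != j ->
    exists v, [/\ v \in V, i \in v & j \in v]) ->
  (\sum_(v in V) #|v :&: D| <= 3 * #|V| + #|D|)%N.
Proof.
move=> injs blockE injV cross.
(* [G] is the set of gaps (i, v, w): v and w are consecutive crossings on i,
   v being the lower one.  At most one line has the largest slope at v, so the
   gaps (i, v, w) with i of largest slope at v number at most #|V|; likewise for
   smallest slope.  The other gaps are determined by their upper end w. *)
pose Inc := [set e : T * {set T} | [&& e.1 \in D, e.2 \in V & e.1 \in e.2]].
pose Bot := [set e in Inc | [forall u in V, (e.1 \in u) ==> (h e.2 <= h u)]].
pose G := [set g : T * {set T} * {set T} |
  [&& g.1.1 \in D, g.1.2 \in V, g.2 \in V, g.1.1 \in g.1.2, g.1.1 \in g.2,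
      h g.1.2 < h g.2 &
      [forall u in V, (g.1.1 \in u) ==> ~~ (h g.1.2 < h u < h g.2)]]].
have GP i v w : (i, v, w) \in G -> [/\ [/\ i \in D, v \in V & w \in V],
    [/\ i \in v, i \in w & h v < h w] &
    forall u, u \in V -> i \in u -> h v < h u -> h u < h w -> False].
  rewrite inE /= => /and5P[-> -> -> -> /and3P[-> -> /forallP gap]].
  split=> // u uV iu hvu huw.
  by have := gap u; rewrite uV iu /= hvu huw.
have eqh i v w : i \in D -> v \in V -> w \in V -> i \in v -> i \in w ->
    h v = h w -> v = w.
  move=> iD vV wV iv iw hvw; apply: injV => //.
  by move: iv iw; rewrite (blockE v) // (blockE w) // => /eqP <- /eqP <-;
    rewrite hvw.
have next_inj i v w w' : (i, v, w) \in G -> (i, v, w') \in G -> w = w'.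
  move=> /GP[[iD vV wV] [iv iw vw] gap] /GP[[_ _ w'V] [_ iw' vw'] gap'].
  apply: (eqh i) => //; case: (ltgtP (h w) (h w')) => // lt.
    by case: (gap' w).
  by case: (gap w').
have prev_inj i v v' w : (i, v, w) \in G -> (i, v', w) \in G -> v = v'.
  move=> /GP[[iD vV wV] [iv iw vw] gap] /GP[[_ v'V _] [iv' _ vw'] gap'].
  apply: (eqh i) => //; case: (ltgtP (h v) (h v')) => // lt.
    by case: (gap v').
  by case: (gap' v).
have cardInc : (\sum_(v in V) #|v :&: D| = #|Inc|)%N.
  rewrite -[RHS]sum1_card.
  rewrite (eq_bigr (fun v : {set T} => \sum_(i in D | i \in v) 1)%N);
    last first.
    by move=> v _; rewrite sum1dep_card; apply: eq_card => i;
      rewrite !inE andbC.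
  rewrite (exchange_big_dep (mem D)) /=; last by move=> ? ? _ /andP[].
  rewrite pair_big_dep /=; apply: eq_bigl => -[i v]; rewrite !inE /=.
  by case: (i \in D); rewrite ?andbF.
have cardBot : (#|Bot| <= #|D|)%N.
  rewrite -(card_in_imset (f := fst)).
    by apply/subset_leq_card/fintype.subsetP => _ /imsetP[[i v] + ->];
      rewrite !inE => /andP[/and3P[]].
  move=> [i v] [i' v']; rewrite !inE /=.
  move=> /andP[/and3P[iD vV iv] /forallP mv] /andP[/and3P[_ v'V iv'] /forallP
    mv'] ii'.
  rewrite -{}ii' in iv' mv' *; congr (_, _); apply: (eqh i) => //.
  apply/le_anti.
  by have := mv v'; have := mv' v; rewrite vV v'V iv iv' /= => -> ->.
have cardG : (#|Inc| <= #|G| + #|Bot|)%N.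
  rewrite -[X in (X <= _)%N](cardsID Bot) addnC leq_add //; last first.
    exact/subset_leq_card/finset.subsetIr.
  apply: leq_trans (leq_imset_card (fun g => (g.1.1, g.2)) G).
  apply/subset_leq_card/fintype.subsetP => -[i w].
  rewrite 2!inE /= => /andP[+ iwInc]; rewrite iwInc /= => nBot.
  move: iwInc; rewrite inE /= => /and3P[iD wV iw].
  move: nBot; rewrite negb_forall => /existsP[u0].
  rewrite !negb_imply -ltNge => /and3P[u0V iu0 hu0].
  pose Q u := [&& u \in V, i \in u & h u < h w].
  have Qu0 : Q u0 by apply/and3P.
  (* The highest crossing on [i] below [w] is the lower end of the gap. *)
  case: (@arg_maxP _ _ _ u0 Q h Qu0) => v /and3P[vV iv vw] maxv.
  apply/imsetP; exists (i, v, w) => //; rewrite inE /= iD vV wV iv iw vw /=.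
  apply/forallP => u; apply/implyP => uV; apply/implyP => iu.
  apply/negP => /andP[vu uw].
  by have := maxv u; rewrite /Q uV iu uw => /(_ isT); rewrite /= leNgt vu.
pose hi (g : T * {set T} * {set T}) := [exists m in D, (m \in g.1.2) && (s
  g.1.1 < s m)].
pose lo (g : T * {set T} * {set T}) := [exists m in D, (m \in g.1.2) && (s m <
  s g.1.1)].
have card1 : (#|[set g in G | ~~ hi g]| <= #|V|)%N.
  rewrite -(card_in_imset (f := fun g => g.1.2)).
    apply/subset_leq_card/fintype.subsetP => _ /imsetP[[[i v] w] + ->].
    by rewrite inE => /andP[/GP[[]]].
  move=> [[i v] w] [[i' v'] w'] /setIdP[g ng] /setIdP[g' ng'] /= vv'.
  rewrite -{}vv' in g' ng' *.
  have [[iD _ _] [iv _ _] _] := GP _ _ _ g.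
  have [[i'D _ _] [i'v _ _] _] := GP _ _ _ g'.
  have ii' : i = i'.
    apply: injs => //; apply/le_anti; rewrite !leNgt.
    apply/andP; split; [apply: contra ng' | apply: contra ng] => lt;
      apply/existsP.
      by exists i; rewrite iD iv.
    by exists i'; rewrite i'D i'v.
  by rewrite -ii' in g' *; rewrite (next_inj _ _ _ _ g g').
have card2 : (#|[set g in G | ~~ lo g]| <= #|V|)%N.
  rewrite -(card_in_imset (f := fun g => g.1.2)).
    apply/subset_leq_card/fintype.subsetP => _ /imsetP[[[i v] w] + ->].
    by rewrite inE => /andP[/GP[[]]].
  move=> [[i v] w] [[i' v'] w'] /setIdP[g ng] /setIdP[g' ng'] /= vv'.
  rewrite -{}vv' in g' ng' *.
  have [[iD _ _] [iv _ _] _] := GP _ _ _ g.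
  have [[i'D _ _] [i'v _ _] _] := GP _ _ _ g'.
  have ii' : i = i'.
    apply: injs => //; apply/le_anti; rewrite !leNgt.
    apply/andP; split; [apply: contra ng | apply: contra ng'] => lt;
      apply/existsP.
      by exists i'; rewrite i'D i'v.
    by exists i; rewrite iD iv.
  by rewrite -ii' in g' *; rewrite (next_inj _ _ _ _ g g').
(* Below w the line i takes smaller values than i'.  Upwards from v the line m
   lies above i, and upwards from v' the line m' lies below i', so the one
   starting at the greater height enters the triangle below w and crosses the
   opposite side inside a gap. *)
have noface i i' v v' w : (i, v, w) \in G -> (i', v', w) \in G ->
    hi (i, v, w) -> lo (i', v', w) -> s i' < s i -> False.
  move=> /GP[[iD vV wV] [iv iw vw] gap] /GP[[i'D v'V _] [i'v' i'w v'w] gap'].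
  move=> /existsP[m /= /and3P[mD mv lt_im]] /existsP[m' /= /and3P[m'D m'v'
    lt_m'i]] lt.
  move: (iv) (iw) (mv) (i'v') (i'w) (m'v').
  rewrite (blockE v i) // => /eqP e1; rewrite (blockE w i) // => /eqP e2.
  rewrite (blockE v m) // => /eqP e3; rewrite (blockE v' i') // => /eqP e4.
  rewrite (blockE w i') // => /eqP e5; rewrite (blockE v' m') // => /eqP e6.
  have lti : 0 < s i - s i' by rewrite subr_gt0.
  have hvw : 0 < h w - h v by rewrite subr_gt0.
  have hv'w : 0 < h w - h v' by rewrite subr_gt0.
  case: (leP (h v) (h v')) => hvv'.
    have lti' : 0 < s i' - s m' by rewrite subr_gt0.
    have im' : i != m' by apply/eqP => E; move: lt lt_m'i; rewrite E; lra.
    have [u [uV iu m'u]] := cross i m' iD m'D im'.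
    move: (iu) (m'u); rewrite (blockE u i) // (blockE u m') // =>
      /eqP e7 /eqP e8.
    have /andP[l1 l2] : h v' < h u < h w.
      apply: (@affine_cross _ (s i) (c i) (s m') (c m')) => //;
        last by rewrite e7.
        rewrite e6 -e4; have := mulr_gt0 lti hv'w; lra.
      rewrite e2 -e5; have := mulr_gt0 lti' hv'w; lra.
    by apply: (gap u) => //; lra.
  have lti' : 0 < s m - s i by rewrite subr_gt0.
  have im' : i' != m by apply/eqP => E; move: lt lt_im; rewrite E; lra.
  have [u [uV iu m'u]] := cross i' m i'D mD im'.
  move: (iu) (m'u); rewrite (blockE u i') // (blockE u m) // => /eqP e7 /eqP e8.
  have /andP[l1 l2] : h v < h u < h w.
    apply: (@affine_cross _ (s m) (c m) (s i') (c i')) => //;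
      last by rewrite e7.
      rewrite e3 -e1; have := mulr_gt0 lti hvw; lra.
    rewrite e5 -e2; have := mulr_gt0 lti' hvw; lra.
  by apply: (gap' u) => //; lra.
have card3 : (#|[set g in G | hi g && lo g]| <= #|V|)%N.
  rewrite -(card_in_imset (f := fun g => g.2)).
    apply/subset_leq_card/fintype.subsetP => _ /imsetP[[[i v] w] + ->].
    by rewrite inE => /andP[/GP[[]]].
  move=> [[i v] w] [[i' v'] w'] /setIdP[g /andP[hg lg]] /setIdP[g' /andP[hg'
    lg']] /= ww'.
  rewrite -{}ww' in g' hg' lg' *.
  have [[iD _ _] _ _] := GP _ _ _ g.
  have [[i'D _ _] _ _] := GP _ _ _ g'.
  have ii' : i = i'.
    apply: injs => //; case: (ltgtP (s i) (s i')) => // lt.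
      by case: (noface _ _ _ _ _ g' g hg' lg lt).
    by case: (noface _ _ _ _ _ g g' hg lg' lt).
  by rewrite -ii' in g' *; rewrite (prev_inj _ _ _ _ g g').
have : (#|G| <= #|[set g in G | ~~ hi g]| + #|[set g in G | ~~ lo g]|
                + #|[set g in G | hi g && lo g]|)%N.
  apply: leq_trans (leq_trans (leq_card_setU _ _) (leq_add (leq_card_setU _ _)
    (leqnn _))).
  apply/subset_leq_card/fintype.subsetP => g; rewrite !inE => ->.
  by case: (hi g); case: (lo g).
rewrite cardInc; lia.
Qed.

(** * Planes spanned by points in space *)

Local Open Scope classical_set_scope.
Local Open Scope fset_scope.
Local Open Scope ring_scope.

(** The product of the [f i] is nonzero, so it cannot vanish at all of [0, ..., size p - 1]. *)
Lemma exists_nonroot (R : realFieldType) (I : finType) (f : I -> {poly R}) :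
  (forall i, f i != 0) -> exists t, forall i, (f i).[t] != 0.
Proof.
move=> f0; pose p := \prod_i f i.
have p0 : p != 0 by apply/prodf_neq0 => i _.
pose rs := [seq k%:R : R | k <- iota 0 (size p)].
have [rt|/allPn[t _ nroot]] := boolP (all (root p) rs).
  have := max_poly_roots p0 rt; rewrite size_map size_iota ltnn.
  by move=> /(_ _)/wrap[]//; rewrite map_inj_uniq ?iota_uniq //;
    apply: mulrIn; rewrite ?oner_eq0.
exists t => i; move: nroot; rewrite /root horner_prod => /prodf_neq0; exact.
Qed.

Definition trace (R : realType) (T : finType) (x : T -> 'rV[R]_3)
    (P : set 'rV[R]_3) : {set T} := [set i | x i \in P]%SET.

Definition blocks (R : realType) (T : finType) (x : T -> 'rV[R]_3) :
    {set {set T}} :=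
  [set B : {set T} | (3 <= #|B|)%N &&
    `[< exists P, is_plane P /\ B = trace x P >]]%SET.

Definition general_position (R : realType) (T : finType) (x : T -> 'rV[R]_3) :
  Prop :=
  injective x /\
  (forall i j l, i != j -> j != l -> i != l -> ~ collinear (x i) (x j) (x l)).

Lemma blocksP (R : realType) (T : finType) (x : T -> 'rV[R]_3) (B : {set T}) :
  reflect ((3 <= #|B|)%N /\ exists P, is_plane P /\ B = trace x P)
    (B \in blocks x).
Proof. by rewrite inE; apply: (iffP andP) => -[B3 /asboolP]. Qed.

Lemma in_trace (R : realType) (T : finType) (x : T -> 'rV[R]_3) P i :
  i \in trace x P <-> P (x i).
Proof. by rewrite inE; split; rewrite ?inE. Qed.

Lemma collinear_shift (R : realType) (p q : 'rV[R]_3) t : q != p ->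
  collinear p q (p + t *: (q - p)).
Proof.
move=> qp; exists [set p + s *: (q - p) | s in [set: R]]; split.
- by exists p, (q - p); rewrite subr_eq0.
- by exists 0 => //; rewrite scale0r addr0.
- by exists 1 => //; rewrite scale1r addrC subrK.
- by exists t.
Qed.

Lemma exists_plane (R : realType) (p q r : 'rV[R]_3) :
  q != p -> ~ collinear p q r ->
  exists P, [/\ is_plane P, P p, P q & P r].
Proof.
move=> qp nc; pose u := q - p; pose v := r - p.
(* The normal is the cross product of [u] and [v], which are not parallel. *)
pose a : 'rV[R]_3 := \row_(i < 3)
  (if i == 0 then u 0 1 * v 0 (2%:R) - u 0 (2%:R) * v 0 1
   else if i == 1 then u 0 (2%:R) * v 0 0 - u 0 0 * v 0 (2%:R)
   else u 0 0 * v 0 1 - u 0 1 * v 0 0).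
have a_0 : a 0 0 = u 0 1 * v 0 (2%:R) - u 0 (2%:R) * v 0 1 by rewrite mxE.
have a_1 : a 0 1 = u 0 (2%:R) * v 0 0 - u 0 0 * v 0 (2%:R) by rewrite mxE.
have a_2 : a 0 (2%:R) = u 0 0 * v 0 1 - u 0 1 * v 0 0 by rewrite mxE.
have a0 : a != 0.
  apply/eqP => a0; apply: nc; move: a_0 a_1 a_2; rewrite a0 !mxE => a_0 a_1 a_2.
  have [||||t vt] := @parallel3 R u v; rewrite ?subr_eq0 //;
    try by rewrite !mxE; lra.
  have -> : r = p + t *: (q - p) by rewrite -vt addrC subrK.
  exact: collinear_shift.
exists [set x | \sum_(i < 3) a 0 i * x 0 i = \sum_(i < 3) a 0 i * p 0 i].
split=> //; first by exists a, (\sum_(i < 3) a 0 i * p 0 i).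
  by rewrite /= !sum3E a_0 a_1 a_2 !mxE; ring.
by rewrite /= !sum3E a_0 a_1 a_2 !mxE; ring.
Qed.

Lemma blocks_steiner (R : realType) (T : finType) (x : T -> 'rV[R]_3) :
  general_position x -> steiner3 (blocks x).
Proof.
move=> [injx ncol]; split=> [P /blocksP[]//|i j l ij jl il].
have nc := ncol i j l ij jl il.
have [|P [pP Pi Pj Pl]] := @exists_plane R (x i) (x j) (x l) _ nc.
  by apply: contra_neq ij => /injx.
apply/eqP/cards1P; exists (trace x P); apply/finset.setP => B.
rewrite !throughE finset.in_set1; apply/idP/eqP => [|->].
  move=> /andP[/andP[/andP[/blocksP[B3 [Q [pQ ->]]]]]].
  move=> /in_trace Ql /in_trace Qj /in_trace Qi.
  by rewrite (plane_unique pQ pP Qi Qj Ql Pi Pj Pl).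
have [iP jP lP] : [/\ i \in trace x P, j \in trace x P & l \in trace x P].
  by split; apply/in_trace.
rewrite iP jP lP !andbT; apply/blocksP; split; last by exists P.
apply: leq_trans (subset_leq_card (A := [set i; j; l]%SET) _); last first.
  by apply/fintype.subsetP => m;
    rewrite !finset.in_setU !finset.in_set1 => /orP[/orP[]|] /eqP ->.
by rewrite -finset.setUA !cardsU1 cards1 !inE negb_or ij il jl.
Qed.

Lemma blocks_through (R : realType) (T : finType) (x : T -> 'rV[R]_3) (p : T)
  (B : {set T}) :
  B \in through p (blocks x) -> exists a : 'rV[R]_3, a != 0 /\
    forall i, i \in B <-> a 0 0 * (x i 0 0 - x p 0 0) +
      a 0 1 * (x i 0 1 - x p 0 1) +
      a 0 (2%:R) * (x i 0 (2%:R) - x p 0 (2%:R)) = 0.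
Proof.
rewrite throughE => /andP[/blocksP[_ [P [[a [b [a0 ->]]] ->]]]].
move=> /in_trace /=; rewrite sum3E => Ep; exists a; split=> // i.
by split=> [/in_trace/=|E]; [|apply/in_trace => /=]; rewrite sum3E; lra.
Qed.

Lemma blocks_incidences (R : realType) (T : finType) (x : T -> 'rV[R]_3) (p :
  T) :
  general_position x ->
  (\sum_(P in through p (blocks x)) #|P|.-1 <=
    3 * #|through p (blocks x)| + #|T|.-1)%N.
Proof.
move=> gx; have [injx ncol] := gx.
(* The functionals phi = (1, t, t^2), psi = (0, 1, u), (0, 0, 1) form a basis,
   with t and u chosen so that no direction x i - x p is killed by phi and no
   two of them have the same ratio psi / phi.  In this basis the plane with
   normal al * phi + be * psi + ga * (0, 0, 1) becomes the crossing at height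
   be / ga of the lines h |-> (psi i / phi i) * h + d2 i / phi i. *)
pose d0 i := x i 0 0 - x p 0 0.
pose d1 i := x i 0 1 - x p 0 1.
pose d2 i := x i 0 (2%:R) - x p 0 (2%:R).
have d_neq0 i : i != p -> [|| d0 i != 0, d1 i != 0 | d2 i != 0].
  move=> ip; have := @row3_eq0 R (x i - x p); rewrite !mxE; apply.
  by rewrite subr_eq0; apply: contra_neq ip => /injx.
have [t phi_neq0] : exists t, forall i, i != p -> d0 i + t * d1 i + t ^+ 2 * d2
  i != 0.
  pose f i := if i == p then 1 else (d0 i)%:P + d1 i *: 'X + d2 i *: 'X^2.
  have [|t ft] := @exists_nonroot R T f.
    move=> i; rewrite /f; have [_|ip] := eqVneq i p; first exact: oner_neq0.
    apply: contraTneq (d_neq0 i ip) => /polyP E; move: (E 0%N) (E 1%N) (E 2%N).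
    by rewrite !coefE /= => E0 E1 E2; rewrite !negb_or !negbK; apply/and3P;
      split; apply/eqP; lra.
  exists t => i ip; have := ft i;
    rewrite /f (negPf ip) !(hornerD, hornerC, hornerZ, hornerX, hornerXn).
  by apply: contra_neq => <-; ring.
pose phi i := d0 i + t * d1 i + t ^+ 2 * d2 i.
(* Coefficients in [u] of [phi i * psi j - phi j * psi i]. If both vanish, [x j - x p] is a multiple
   of [x i - x p], against general position. *)
pose w1 i j := phi i * d1 j - phi j * d1 i.
pose w2 i j := phi i * d2 j - phi j * d2 i.
have w_neq0 i j : i != p -> j != p -> i != j -> (w1 i j != 0) || (w2 i j != 0).
  move=> ip jp ij; apply/negPn; rewrite negb_or !negbK;
    apply/negP => /andP[/eqP e1 /eqP e2].
  have phi0 := phi_neq0 i ip; rewrite -/(phi i) in phi0.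
  have e0 : phi i * d0 j = phi j * d0 i.
    have -> : d0 j = phi j - t * d1 j - t ^+ 2 * d2 j by rewrite /phi; ring.
    have -> : d0 i = phi i - t * d1 i - t ^+ 2 * d2 i by rewrite /phi; ring.
    apply/eqP; rewrite -subr_eq0; apply/eqP.
    transitivity (- t * w1 i j - t ^+ 2 * w2 i j); first by rewrite /w1 /w2;
      ring.
    by rewrite e1 e2; ring.
  apply: (ncol p i j); rewrite // 1?eq_sym //.
  have -> : x j = x p + (phi j / phi i) *: (x i - x p).
    apply: row3P; rewrite !mxE; apply: (mulfI phi0).
    - transitivity (phi i * d0 j + phi i * x p 0 0); first by rewrite /d0; ring.
      by rewrite e0 /d0; field.
    - transitivity (w1 i j + phi j * d1 i + phi i * x p 0 1);
      first by rewrite /w1 /d1; ring.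
      by rewrite e1 /d1; field.
    - transitivity (w2 i j + phi j * d2 i + phi i * x p 0 (2%:R));
      first by rewrite /w2 /d2; ring.
      by rewrite e2 /d2; field.
  by apply: collinear_shift; apply: contra_neq ip => /injx.
have [u psi_neq] : exists u, forall i j, i != p -> j != p -> i != j ->
    w1 i j + u * w2 i j != 0.
  pose f (ij : T * T) := if [&& ij.1 != p, ij.2 != p & ij.1 != ij.2]
    then (w1 ij.1 ij.2)%:P + w2 ij.1 ij.2 *: 'X else 1.
  have [|u fu] := @exists_nonroot R _ f.
    move=> ij; rewrite /f; case: ifP => [/and3P[ip jp ij']|_];
      last exact: oner_neq0.
    apply: contraTneq (w_neq0 _ _ ip jp ij') => /polyP E; move: (E 0%N) (E 1%N).
    by rewrite !coefE /= => E0 E1; rewrite negb_or !negbK; apply/andP; split;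
      apply/eqP; lra.
  exists u => i j ip jp ij; have := fu (i, j);
    rewrite /f /= ip jp ij /= !(hornerD, hornerC, hornerZ, hornerX).
  by apply: contra_neq => <-; ring.
pose psi i := d1 i + u * d2 i.
(* The default 0 does not occur for blocks through [p], which have a normal. *)
pose nrm (B : {set T}) : 'rV[R]_3 := xget 0 [set a : 'rV[R]_3 | a != 0 /\
  forall i, i \in B <-> a 0 0 * d0 i + a 0 1 * d1 i + a 0 (2%:R) * d2 i = 0].
have nrmP B : B \in through p (blocks x) -> nrm B != 0 /\
    forall i, i \in B <-> nrm B 0 0 * d0 i + nrm B 0 1 * d1 i + nrm B 0 (2%:R)
      * d2 i = 0.
  by move=> /blocks_through[a ?]; rewrite /nrm; case: xgetP => [? _ //|/(_ a)].
(* Coordinates of the normal in the basis [phi], [psi], [d2]. *)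
pose al B : R := nrm B 0 0.
pose be B := nrm B 0 1 - t * al B.
pose ga B := nrm B 0 (2%:R) - t ^+ 2 * al B - u * be B.
have inB B i : B \in through p (blocks x) -> i \in B <->
    al B * phi i + be B * psi i + ga B * d2 i = 0.
  move=> /nrmP[_ ->]; rewrite /ga /be /al /psi /phi.
  by split=> <-; ring.
(* No crossing lies at infinity: otherwise [al * phi + be * psi] vanishes at two further points of
   [B], whose ratios [psi / phi] differ, and the normal is zero. *)
have ga_neq0 B : B \in through p (blocks x) -> ga B != 0.
  move=> BF; have [n0 _] := nrmP B BF; apply/eqP => ga0.
  have := BF; rewrite throughE => /andP[/blocksP[B3 _] pB].
  move: B3; rewrite (cardsD1 p) pB ltnS => /card_gt1P[i [j [+ + ij]]].
  rewrite !inE => /andP[ip iB] /andP[jp jB].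
  move: iB jB; rewrite !inB // ga0 !mul0r !addr0 => ei ej.
  have be0 : be B = 0.
    apply/eqP; apply: contraTT (psi_neq i j ip jp ij) => b0; rewrite negbK.
    rewrite -(mulrI_eq0 _ (mulfI b0)); apply/eqP.
    transitivity (phi i * (al B * phi j + be B * psi j)
      - phi j * (al B * phi i + be B * psi i)); first by rewrite /w1 /w2 /psi;
        ring.
    by rewrite ei ej; ring.
  have al0 : al B = 0.
    by move/eqP: ei; rewrite be0 mul0r addr0 mulf_eq0 (negPf (phi_neq0 i ip))
      orbF => /eqP.
  case/eqP: n0; apply: row3P; rewrite !mxE -/(al B) //.
    by move: be0; rewrite /be al0; lra.
  by move: ga0; rewrite /ga be0 al0; lra.
have := @sum_card_le_gaps R T [set~ p]%SET (through p (blocks x))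
  (fun i => psi i / phi i) (fun i => d2 i / phi i)
  (fun B => be B / ga B) (fun B => - al B / ga B).
have blockE v i : v \in through p (blocks x) -> i \in [set~ p]%SET ->
    (i \in v) = (psi i / phi i * (be v / ga v) + d2 i / phi i == - al v / ga v).
  move=> vF; rewrite !inE => ip; have g0 := ga_neq0 v vF;
    have f0 := phi_neq0 i ip.
  rewrite -/(phi i) in f0.
  rewrite -subr_eq0.
  have -> : psi i / phi i * (be v / ga v) + d2 i / phi i - - al v / ga v =
     (al v * phi i + be v * psi i + ga v * d2 i) / (phi i * ga v).
    by field; rewrite g0 f0.
  rewrite mulf_eq0 invr_eq0 mulf_eq0 (negPf g0) (negPf f0) !orbF.
  by apply/idP/eqP => /inB; apply.
move=> /(_ _ blockE) gaps.
rewrite -(cardsC1 p); apply: leq_trans (gaps _ _ _).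
- apply: eq_leq; apply: eq_bigr => P; rewrite throughE => /andP[_ pP].
  by rewrite (cardsD1 p) pP finset.setDE.
- move=> i j; rewrite !inE => ip jp e; apply/eqP; apply: contraT => ij.
  have f0 := phi_neq0 i ip; have f0' := phi_neq0 j jp.
  rewrite -/(phi i) in f0; rewrite -/(phi j) in f0'.
  case/eqP: (psi_neq i j ip jp ij).
  transitivity (phi i * phi j * (psi j / phi j - psi i / phi i)).
    by rewrite /w1 /w2 /psi; field; rewrite f0 f0'.
  by rewrite e subrr mulr0.
- move=> v v' vF v'F eh ey; apply/finset.setP => i; have [->|ip] := eqVneq i p.
    by move: vF v'F; rewrite !throughE => /andP[_ ->] /andP[_ ->].
  have iD : i \in [set~ p]%SET by rewrite !inE.
  by rewrite (blockE v i vF iD) (blockE v' i v'F iD) eh ey.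
- move=> i j; rewrite !inE => ip jp ij.
  (* The lines [i] and [j] cross at the block through [i], [j] and [p]. *)
  have [_ /(_ i j p ij jp ip)/eqP/cards1P[B EB]] := blocks_steiner gx.
  exists B; have : B \in [set B]%SET by rewrite inE.
  rewrite -EB !throughE => /andP[/andP[/andP[BF pB] jB] iB].
  by rewrite BF pB.
Qed.

(** * From blocks back to planes *)

Lemma num_points_on_trace (R : realType) (S : {fset 'rV[R]_3}) P :
  num_points_on S P = #|trace (fun i : S => val i) P|.
Proof.
rewrite cardE -(size_map val); apply/perm_size/uniq_perm.
- exact: fset_uniq.
- by rewrite (map_inj_uniq val_inj) enum_uniq.
move=> v; apply/idP/mapP => [|[i + ->]]; rewrite ?mem_enum.
  rewrite !inE => /andP[vS vP]; exists [` vS] => //.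
  by rewrite mem_enum finset.inE.
by rewrite finset.inE => iP; rewrite !inE iP andbT; apply: valP.
Qed.

(** Each such block is the trace of a plane with [j] points. *)
Lemma card_blocks_le (R : realType) (S : {fset 'rV[R]_3}) (j : nat) :
  (3 <= j)%N -> no_three_collinear S ->
  (#|[set B in blocks (fun i : S =>
    val i) | #|B| == j]%SET| <= num_planes S j)%N.
Proof.
move=> j3 hS; rewrite cardE /num_planes.
set X := fset_set _.
rewrite -(size_map (trace (fun i : S => val i)) X).
apply: uniq_leq_size; first exact: enum_uniq.
move=> B; rewrite mem_enum 2!finset.inE =>
  /andP[/andP[_ /asboolP[P [pP ->]]] /eqP cP].
apply: map_f; rewrite in_fset_set; last exact: finite_planes_with.
by apply/mem_set; split=> //; rewrite num_points_on_trace.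
Qed.

Theorem theorem5 (R : realType) (k n : nat) (S : {fset 'rV[R]_3})
    (hk : (1 <= k)%N) (hS : #|` S| = n)
    (hcol : no_three_collinear S)
    (hplane : forall P : set 'rV[R]_3, is_plane P ->
      (num_points_on S P <= n - k)%N)
    (hn : (184%:R + 8%:R / 25%:R) * k%:R ^+ 2 + 4%:R * k%:R <= n%:R :> R) :
  k%:R * 'C(n - k, 2)%:R - (n - k)%:R * 'C(k, 2)%:R
    <= (num_planes S 3 + num_planes S 4)%:R :> R.
Proof.
pose x (i : S) : 'rV[R]_3 := val i.
have gx : general_position x.
  split=> [i j|i j l ij jl il]; first exact: val_inj.
  by apply: hcol => //; exact: valP.
have cardS : #|{: S}| = n by rewrite -cardfE.
have nk : (184 * k ^ 2 + 4 * k < n)%N.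
  rewrite -(ltr_nat R) natrD natrM natrX natrM; apply: lt_le_trans hn.
  (* The surplus [8k^2 / 25] makes the inequality strict. *)
  have k2 : 0 < k%:R ^+ 2 :> R by rewrite exprn_gt0 // ltr0n.
  lra.
have := @steiner_ordinary S (blocks x) k (blocks_steiner gx)
  (fun p => blocks_incidences p gx) hk.
rewrite cardS => /(_ nk) main.
have {main} main : (k * ((n - k) * (n - k).-1) <=
    2 * #|ordinary (blocks x)| + (n - k) * (k * k.-1))%N.
  apply: main => P /blocksP[_ [Q [pQ ->]]].
  by rewrite -num_points_on_trace; apply: hplane.
have ord_le : (#|ordinary (blocks x)| <= num_planes S 3 + num_planes S 4)%N.
  apply: leq_trans (leq_add (card_blocks_le _ hcol) (card_blocks_le _ hcol)) =>
    //.
  apply: leq_trans (leq_card_setU _ _); apply: subset_leq_card.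
  by apply/fintype.subsetP => B; rewrite !finset.inE andb_orr.
rewrite lerBlDr -!natrM -natrD ler_nat.
(* Both sides are doubled to turn binomials into products. *)
have C2 m : ('C(m, 2) * 2 = m * m.-1)%N by rewrite bin2 muln2 even_halfK //
  oddM; case: m => //= m; case: (odd m).
have := C2 k; have := C2 (n - k)%N => e1 e2.
rewrite -(leq_pmul2r (isT : (0 < 2)%N)) mulnDl -!mulnA e1 e2.
by apply: leq_trans main _; rewrite mulnC leq_add2r leq_mul2r ord_le orbT.
Qed.
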